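(* There is a deterministic comparison algorithm that computes $MAX_n^{\boxplus n}$ (equivalently $MIN_n^{\boxplus n}$) using time $T\in O(n\log n)$ and space $S\in O(\log n)$.
   Context: $MAX_n$ (resp. $MIN_n$) returns the maximum (resp. minimum) of $n$ elements from a totally ordered set. $MAX_n^{\boxplus n}$ maps $x=(x_1,\ldots,x_{2n-1})$ to $(MAX_n(x_i,\ldots,x_{i+n-1}))_{i=1}^n$, and similarly for $MIN$. A comparison algorithm accesses input values only via comparisons; space is in bits, excluding read-only input and write-only output. *)

(* Defs.v *)
From HB Require Import structures.
From mathcomp Require Import all_boot all_order all_algebra.
From mathcomp Require Import all_classical all_reals all_analysis.
Set Implicit Arguments.
Unset Strict Implicit.
Unset Printing Implicit Defensive.
Import Order.TTheory GRing.Theory Num.Theory numFieldNormedType.Exports.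

Lemma window_subproof (n t : nat) (i : 'I_t) (j : 'I_n) : i + j < (n + t).-1.
Proof.
case: n j => [[]//|n] j; rewrite addSn /= addnC -addnS.
by rewrite leq_add // -ltnS.
Qed.

(** The operator [f^{boxplus t}]: the [i]-th output is the value of [f] on the
    window of [n] consecutive inputs that starts at [i]. Positions are counted
    from [0]. *)
Definition sliding (A B : Type) (n t : nat) (f : n.-tuple A -> B)
    (x : (n + t).-1.-tuple A) : t.-tuple B :=
  [tuple f [tuple tnth x (Ordinal (window_subproof i j)) | j < n] | i < t].

(** A totally ordered set need not have a least or a greatest element, so the
    first entry is the default value of the iterated operation. *)
Definition MAX (d : Order.disp_t) (T : orderType d) (n : nat)
    (x : n.+1.-tuple T) : T := \big[Order.max/thead x]_(a <- x) a.

Definition MIN (d : Order.disp_t) (T : orderType d) (n : nat)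
    (x : n.+1.-tuple T) : T := \big[Order.min/thead x]_(a <- x) a.

(** A comparison algorithm is a program of a random access machine whose working
    memory holds natural numbers only. An input value is never stored: it is
    named by its position, and [Compare] is the only instruction whose effect on
    the control flow or on the memory depends on the input. *)
Inductive arith := Add | Sub | Mul | Div.

Definition eval_arith (o : arith) : nat -> nat -> nat :=
  match o with Add => addn | Sub => subn | Mul => muln | Div => divn end.

(** With [m[r]] the content of cell [r] and [x] the input:
    - [Const r k]      : [m[r] := k];
    - [Arith o r s t]  : [m[r] := m[s] o m[t]] ([Sub] is truncated, [Div] is the
                         Euclidean quotient, with quotient [0] by [0]);
    - [LoadInd r s]    : [m[r] := m[m[s]]];
    - [StoreInd r s]   : [m[m[r]] := m[s]];
    - [JumpLe r s l]   : go to line [l] if [m[r] <= m[s]];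
    - [Compare r s l]  : go to line [l] if [x_(m[r]) <= x_(m[s])];
    - [Output r s]     : write the value [x_(m[s])] as output number [m[r]];
    - [Halt]           : stop. *)
Inductive instr :=
  | Const of nat & nat
  | Arith of arith & nat & nat & nat
  | LoadInd of nat & nat
  | StoreInd of nat & nat
  | JumpLe of nat & nat & nat
  | Compare of nat & nat & nat
  | Output of nat & nat
  | Halt.

Definition program := seq instr.

(** [written] is the write-only output: the (output number, value) pairs written
    so far, the latest one first. *)
Record config (T : Type) := Config {
  pc : nat;
  memory : seq nat;
  written : seq (nat * T)
}.

(** The only data given besides the read-only input is the size parameter [n],
    in cell [0]. *)
Definition init (T : Type) (n : nat) : config T := Config 0 [:: n] [::].

(** [None] when the machine has halted, and also when it is faulty: jump outside
    of the program or access outside of the input. Every instruction costs one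
    unit of time; with a space bound in [O(log n)], all the words have [O(log n)]
    bits. *)
Definition step (d : Order.disp_t) (T : orderType d) (p : program) (x : seq T)
    (c : config T) : option (config T) :=
  let: Config l m w := c in
  let get r := nth 0 m r in
  let put r v := Some (Config l.+1 (set_nth 0 m r v) w) in
  match onth p l with
  | Some (Const r k) => put r k
  | Some (Arith o r s t) => put r (eval_arith o (get s) (get t))
  | Some (LoadInd r s) => put r (get (get s))
  | Some (StoreInd r s) => put (get r) (get s)
  | Some (JumpLe r s l') =>
      Some (Config (if get r <= get s then l' else l.+1) m w)
  | Some (Compare r s l') =>
      match onth x (get r), onth x (get s) with
      | Some a, Some b => Some (Config (if (a <= b)%O then l' else l.+1) m w)
      | _, _ => None
      end
  | Some (Output r s) =>
      if onth x (get s) is Some a then Some (Config l.+1 m ((get r, a) :: w))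
      else None
  | Some Halt | None => None
  end.

Definition run (d : Order.disp_t) (T : orderType d) (p : program) (n : nat)
    (x : seq T) (t : nat) : option (config T) :=
  iter t (obind (step p x)) (Some (init T n)).

Definition halted (T : Type) (p : program) (c : config T) : Prop :=
  onth p (pc c) = Some Halt.

(** Length of the binary representation; the number [0] takes one bit. *)
Definition nbits (k : nat) : nat := (trunc_log 2 k).+1.

(** All the cells up to the highest one ever written are counted, so that no
    information can be stored for free in the addresses. The input and the output
    are not counted. *)
Definition space_used (T : Type) (c : config T) : nat :=
  nbits (pc c) + sumn (map nbits (memory c)).

(** The program [p], which depends neither on [n] nor on the ordered set, maps
    every input of [F n] to its image: it stops without fault after at most
    [time n] steps, uses at most [space n] bits at any moment, and writes each
    entry of the image exactly once, in any order. *)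
Definition computes (p : program)
    (F : forall (d : Order.disp_t) (T : orderType d) (n : nat),
       (n.+1 + n.+1).-1.-tuple T -> n.+1.-tuple T)
    (time space : nat -> nat) : Prop :=
  forall (d : Order.disp_t) (T : orderType d) (n : nat)
         (x : (n.+1 + n.+1).-1.-tuple T),
  exists (t : nat) (c : config T),
    [/\ t <= time n.+1,
        run p n.+1 x t = Some c,
        halted p c,
        forall (u : nat) (c' : config T),
          u <= t -> run p n.+1 x u = Some c' -> space_used c' <= space n.+1
      & perm_eq (written c)
                [seq (nat_of_ord i, tnth (F d T n x) i) | i <- enum 'I_n.+1]].

Definition sliding_MAX (d : Order.disp_t) (T : orderType d) (n : nat) :
  (n.+1 + n.+1).-1.-tuple T -> n.+1.-tuple T := sliding (@MAX d T n).

Definition sliding_MIN (d : Order.disp_t) (T : orderType d) (n : nat) :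
  (n.+1 + n.+1).-1.-tuple T -> n.+1.-tuple T := sliding (@MIN d T n).

Local Open Scope classical_set_scope.

(** [f] is in [O(g)], for a bound [g] given over all the models of the reals. *)
Definition in_bigO (f : nat -> nat) (g : forall R : realType, nat -> R) : Prop :=
  forall R : realType, ((fun n => (f n)%:R%R) : nat -> R) =O_\oo (g R).

(* Main.v *)
(** The window that starts at [s] consists of the end [s, n) of the left block
    [0, n) and of the beginning [n, s + n) of the right block. When [s] grows, the
    former shrinks and the latter grows, so there is a [c] such that the maximum is
    attained in the left part for [s < c] and in the right part for [c <= s]. A
    binary search finds [c]: each of its O(log n) steps scans one window for the
    position of a maximum. Then one backward pass over the left block, which
    maintains the position of the maximum of [s, n), gives the outputs [s < c], and
    one forward pass over the right block gives the others. The memory holds only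
    nine numbers, all at most [4 n]. The minimum is the maximum for the dual
    order, i.e. the same program with the operands of [Compare] swapped. *)
Require Import Defs.
From mathcomp Require Import all_boot all_order all_algebra.
From mathcomp Require Import all_classical all_reals all_analysis.
From mathcomp Require Import zify.
Import Order.TTheory GRing.Theory Num.Theory.
Import numFieldNormedType.Exports.
Set Implicit Arguments.
Unset Strict Implicit.
Unset Printing Implicit Defensive.

(** * Termination within a step budget *)

Section Termination.
Variables (C : Type) (f : C -> option C) (safe final : C -> Prop).

(** The budget is only an upper bound, so branches of different lengths can be joined by
    [terminates_le]. Each piece of the program is then specified by continuation: termination from
    its exit implies termination from its entry. *)
Inductive terminates : nat -> C -> Prop :=
  | Terminates_now b c : safe c -> final c -> terminates b c
  | Terminates_step b c c' :
      safe c -> f c = Some c' -> terminates b c' -> terminates b.+1 c.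

Lemma terminates_le b b' c : b <= b' -> terminates b c -> terminates b' c.
Proof.
move=> + t; elim: t b'.
  move=> {}b {}c sc fc b' _; exact: Terminates_now.
move=> {}b {}c c' sc fc _ IH [//|b'] le_b.
by apply: Terminates_step fc _ => //; apply: IH.
Qed.

Lemma terminates_step b c c' :
  0 < b -> safe c -> f c = Some c' -> terminates b.-1 c' -> terminates b c.
Proof. by case: b => // b _; apply: Terminates_step. Qed.

Lemma terminates_iter b c : terminates b c ->
  exists t c', [/\ t <= b, iter t (obind f) (Some c) = Some c', final c'
    & forall u c'', u <= t -> iter u (obind f) (Some c) = Some c'' -> safe c''].
Proof.
elim=> {b c} [b c sc fc|b c c1 sc fc _ [t [c' [le_t Et fc' safe_t]]]].
  exists 0, c; split=> // u c''; rewrite leqn0 => /eqP -> /= [<-] //.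
exists t.+1, c'; split=> //; first by rewrite iterSr /= fc.
move=> [|u] c'' le_u; first by case=> <-.
by rewrite iterSr /= fc; apply: safe_t.
Qed.
End Termination.

Lemma MAX_eq (d : Order.disp_t) (T : orderType d) (n : nat) (y : n.+1.-tuple T)
    (k : 'I_n.+1) :
  (forall j, (tnth y j <= tnth y k)%O) -> MAX y = tnth y k.
Proof.
move=> ub; apply/le_anti/andP; split; last first.
  exact: (@le_bigmax_seq _ _ T y (thead y) (tnth y k) predT id (mem_tnth k y)).
rewrite /MAX big_seq; apply: bigmax_le => [|a /tnthP[j ->]]; exact: ub.
Qed.

Lemma sliding_MAX_nth (d : Order.disp_t) (T : orderType d) (n : nat)
    (x : (n.+1 + n.+1).-1.-tuple T) (x0 : T) (s p : nat) :
  s < n.+1 -> s <= p < s + n.+1 ->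
  (forall j, s <= j < s + n.+1 -> (nth x0 x j <= nth x0 x p)%O) ->
  nth x0 (sliding_MAX x) s = nth x0 x p.
Proof.
move=> lt_s /andP[le_sp lt_p] ub.
have lt_k : p - s < n.+1 by lia.
rewrite (nth_map (Ordinal lt_s)) ?size_enum_ord //.
rewrite (MAX_eq (k := Ordinal lt_k)) => [|j].
  by rewrite tnth_mktuple (tnth_nth x0) /= nth_enum_ord // subnKC.
rewrite !tnth_mktuple !(tnth_nth x0) /= !nth_enum_ord // subnKC //.
by apply: ub; have := ltn_ord j; lia.
Qed.

(** * The program and its memory bounds *)

(* The cells 0 to 8 hold n, 1, 2, lo, hi, s, i, p and a loop bound. The labels are
   line numbers; a jump that compares cell 0 with itself is unconditional. *)
Definition sliding_max_program : program := [::
  (* 0: constants 1 and 2; lo := 0, hi := n *)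
  Const 1 1;
  Const 2 2;
  Const 3 0;
  Const 8 0;
  Arith Add 4 0 3;
  (* 5: binary search, while lo < hi: s := (lo + hi) / 2 *)
  JumpLe 4 3 21;
  Arith Add 5 3 4;
  Arith Div 5 5 2;
  (* 8: p := position of a maximum of the window of s *)
  Arith Mul 7 5 1;
  Arith Mul 6 5 1;
  Arith Add 8 5 0;
  (* 11 *)
  JumpLe 8 6 16;
  Compare 6 7 14;
  Arith Mul 7 6 1;
  (* 14 *)
  Arith Add 6 6 1;
  JumpLe 0 0 11;
  (* 16: hi := s if n <= p, and lo := s + 1 otherwise *)
  JumpLe 0 7 19;
  Arith Add 3 5 1;
  JumpLe 0 0 5;
  (* 19 *)
  Arith Mul 4 5 1;
  JumpLe 0 0 5;
  (* 21: backward pass, i from n - 1 down to 0: p := argmax of [i, n) *)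
  Arith Defs.Sub 7 0 1;
  Arith Mul 6 0 1;
  (* 23 *)
  JumpLe 1 6 25;
  JumpLe 0 0 31;
  (* 25 *)
  Arith Defs.Sub 6 6 1;
  Compare 6 7 28;
  Arith Mul 7 6 1;
  (* 28: output number i if i < lo *)
  JumpLe 3 6 23;
  Output 6 7;
  JumpLe 0 0 23;
  (* 31: forward pass, i from n to 2 n - 2: p := argmax of [n, i] *)
  Arith Mul 6 0 1;
  Arith Mul 7 0 1;
  Arith Add 8 0 0;
  Arith Defs.Sub 8 8 1;
  (* 35 *)
  JumpLe 8 6 44;
  Compare 6 7 38;
  Arith Mul 7 6 1;
  (* 38 *)
  Arith Add 6 6 1;
  (* 39: with i already incremented, output number s := i - n if lo <= s *)
  Arith Defs.Sub 5 6 0;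
  JumpLe 3 5 42;
  JumpLe 0 0 35;
  (* 42 *)
  Output 5 7;
  JumpLe 0 0 35;
  (* 44 *)
  Halt ].

Definition fits (T : Type) (n : nat) (c : config T) : Prop :=
  [/\ pc c < 45, size (memory c) <= 9 & all (leq^~ (4 * n)) (memory c)].

(** * Correctness and running time *)

Section SlidingMax.
Variables (d : Order.disp_t) (T : orderType d) (n : nat) (x : seq T) (x0 : T).
Variable out : nat -> T.
Hypothesis n_gt0 : 0 < n.
Hypothesis size_x : size x = (n + n).-1.
Hypothesis outE : forall s p, s < n -> s <= p < s + n ->
  (forall j, s <= j < s + n -> (nth x0 x j <= nth x0 x p)%O) ->
  out s = nth x0 x p.

Local Notation prog := sliding_max_program.
Local Notation "''x_' i" := (nth x0 x i) (at level 8, i at level 2).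

Definition done (c : config T) : Prop :=
  halted prog c /\
  perm_eq (written c) [seq (s, out s) | s <- iota 0 n].

Local Notation term := (terminates (step prog x) (fits n) done).

Lemma onth_x i : i < (n + n).-1 -> onth x i = Some 'x_i.
Proof. by move=> lt_i; rewrite onthE (nth_map x0) ?size_x. Qed.

Lemma terminates_compare b l r s l' (m : seq nat) (w : seq (nat * T)) :
  onth prog l = Some (Compare r s l') ->
  nth 0 m r < (n + n).-1 -> nth 0 m s < (n + n).-1 ->
  0 < b -> fits n (Config l m w) ->
  term b.-1 (Config (if ('x_(nth 0 m r) <= 'x_(nth 0 m s))%O then l' else l.+1)
                    m w) ->
  term b (Config l m w).
Proof.
move=> El lt_r lt_s b_gt0 fit; apply: terminates_step => //.
by rewrite /step El !onth_x.
Qed.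

Lemma terminates_output b l r s (m : seq nat) (w : seq (nat * T)) :
  onth prog l = Some (Output r s) -> nth 0 m s < (n + n).-1 ->
  0 < b -> fits n (Config l m w) ->
  term b.-1 (Config l.+1 m ((nth 0 m r, 'x_(nth 0 m s)) :: w)) ->
  term b (Config l m w).
Proof.
move=> El lt_s b_gt0 fit; apply: terminates_step => //.
by rewrite /step El !onth_x.
Qed.

Definition cells lo hi s i p e : seq nat := [:: n; 1; 2; lo; hi; s; i; p; e].

(** The place of [p] is left out, so that a placeholder [p] is allowed while [[a, b)] is still
    empty. *)
Definition bounds a b p := forall j, a <= j < b -> ('x_j <= 'x_p)%O.

Lemma bounds_right a b p : bounds a b p -> ('x_b <= 'x_p)%O -> bounds a b.+1 p.
Proof.
move=> ub le_b j /andP[le_aj]; rewrite ltnS leq_eqVlt => /predU1P[-> //|lt_jb].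
by apply: ub; rewrite le_aj.
Qed.

Lemma bounds_right_max a b p :
  bounds a b p -> ('x_p <= 'x_b)%O -> bounds a b.+1 b.
Proof.
by move=> ub le_b; apply: bounds_right => // j /ub le_j; apply: le_trans le_b.
Qed.

Lemma bounds_left a b p : bounds a.+1 b p -> ('x_a <= 'x_p)%O -> bounds a b p.
Proof.
move=> ub le_a j /andP[]; rewrite leq_eqVlt => /predU1P[<- //|lt_aj lt_jb].
by apply: ub; rewrite lt_aj.
Qed.

Lemma bounds_left_max a b p :
  bounds a.+1 b p -> ('x_p <= 'x_a)%O -> bounds a b a.
Proof.
by move=> ub le_a; apply: bounds_left => // j /ub le_j; apply: le_trans le_a.
Qed.

Ltac fit := split=> //=; lia.
Ltac exec := apply: terminates_step; [lia | fit | reflexivity | rewrite /= ].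

(** Induction on the number [k] of positions left to scan; a round takes at most five instructions,
    and the final loop test takes one. *)
Lemma scan_correct lo hi s w b :
  lo <= n -> hi <= n -> s < n ->
  (forall p, s <= p < s + n -> bounds s (s + n) p ->
     term b (Config 16 (cells lo hi s (s + n) p (s + n)) w)) ->
  forall k i p, i + k = s + n -> s <= i -> s <= p < s + n -> bounds s i p ->
  term (b + 5 * k + 1) (Config 11 (cells lo hi s i p (s + n)) w).
Proof.
move=> le_lo le_hi lt_s post; elim=> [|k IH] i p Ei le_i lt_p ub.
  rewrite addn0 in Ei; subst i.
  exec; rewrite leqnn; apply: terminates_le (post _ lt_p ub); lia.
exec; rewrite ifF; last lia.
apply: terminates_compare => //=; [lia | lia | lia | fit |].
have next p' : s <= p' < s + n -> bounds s i.+1 p' ->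
    term (b + 5 * k + 3) (Config 14 (cells lo hi s i p' (s + n)) w).
  move=> lt_p' ub'; exec; exec; rewrite leqnn addn1.
  by apply: terminates_le (IH i.+1 p' _ _ lt_p' ub'); lia.
case: ifPn => [le_ip|]; last rewrite -ltNge => /ltW le_pi.
  by apply: terminates_le (next p lt_p (bounds_right ub le_ip)); lia.
exec; rewrite muln1.
by apply: terminates_le (next i _ (bounds_right_max ub le_pi)); lia.
Qed.


(** * The crossing point and its binary search *)

Definition left_max s :=
  forall j, n <= j < s + n -> exists2 p, s <= p < n & ('x_j <= 'x_p)%O.

Definition right_max s :=
  forall j, s <= j < n -> exists2 p, n <= p < s + n & ('x_j <= 'x_p)%O.

Lemma left_max_bounds s p : bounds s n p -> left_max s -> bounds s (s + n) p.
Proof.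
move=> ub lmax j lt_j; case: (ltnP j n) => le_nj; first by apply: ub; lia.
have [|k lt_k le_jk] := lmax j; first lia.
exact: le_trans le_jk (ub k lt_k).
Qed.

Lemma right_max_bounds s p :
  bounds n (s + n) p -> right_max s -> bounds s (s + n) p.
Proof.
move=> ub rmax j lt_j; case: (ltnP j n) => le_nj; last by apply: ub; lia.
have [|k lt_k le_jk] := rmax j; first lia.
exact: le_trans le_jk (ub k lt_k).
Qed.

Definition outputs a b : seq (nat * T) :=
  [seq (s, out s) | s <- iota a (b - a)].

Lemma outputs_rcons a b :
  a <= b -> outputs a b.+1 = rcons (outputs a b) (b, out b).
Proof.
by move=> le_ab; rewrite /outputs subSn // -addn1 iotaD map_cat cats1 subnKC.
Qed.

Lemma outputs_cons a b : a < b -> outputs a b = (a, out a) :: outputs a.+1 b.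
Proof.
move=> lt_ab; rewrite /outputs subnS.
by case: (b - a) (subn_gt0 a b) => [|k] //=; lia.
Qed.

Lemma outputs_nil a b : b <= a -> outputs a b = [::].
Proof. by rewrite -subn_eq0 /outputs => /eqP ->. Qed.

(** The length [hi - lo] is at least halved by each round, which costs one scan and a constant.
    Outside [[lo, hi)] the side of the maximum is already known. *)
Lemma search_correct w b :
  (forall c s i p e,
     c <= n -> s <= n -> i <= 4 * n -> p <= 4 * n -> e <= 4 * n ->
     (forall s', s' < c -> left_max s') ->
     (forall s', c <= s' < n -> right_max s') ->
     term b (Config 21 (cells c c s i p e) w)) ->
  forall k lo hi s i p e, hi - lo < 2 ^ k -> lo <= hi <= n ->
  s <= n -> i <= 4 * n -> p <= 4 * n -> e <= 4 * n ->
  (forall s', s' < lo -> left_max s') ->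
  (forall s', hi <= s' < n -> right_max s') ->
  term (b + k * (5 * n + 12) + 1) (Config 5 (cells lo hi s i p e) w).
Proof.
move=> post k lo hi s i p e; elim: k lo hi s i p e => [|k IH] lo hi s i p e lt_k
  le_n le_s le_i le_p le_e lmax rmax; case: (leqP hi lo) => [le_hi|lt_lo].
- have E : hi = lo by lia.
  subst hi; exec; rewrite leqnn.
  by apply: terminates_le (post lo s i p e _ _ _ _ _ lmax rmax); lia.
- by move: lt_k; rewrite expn0; lia.
- have E : hi = lo by lia.
  subst hi; exec; rewrite leqnn.
  by apply: terminates_le (post lo s i p e _ _ _ _ _ lmax rmax); lia.
exec; rewrite ifF; last lia.
exec; exec.
set mid := (lo + hi) %/ 2; have [le_mid lt_mid] : lo <= mid /\ mid < hi by lia.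
exec; exec; exec; rewrite muln1.
have lt_k' : hi - mid.+1 < 2 ^ k /\ mid - lo < 2 ^ k.
  by move: lt_k; rewrite expnS; lia.
have scan :=
  @scan_correct lo hi mid w (b + k * (5 * n + 12) + 4) _ _ _ _ n mid mid.
apply: terminates_le (scan _ _ _ _ _ _ _ _); try lia; last first.
  by move=> j; lia.
move=> {i p e le_i le_p le_e} p lt_p ub.
case: (leqP n p) => [le_np|lt_pn].
  exec; rewrite le_np; exec; exec; rewrite leqnn muln1.
  apply: terminates_le
    (IH lo mid mid (mid + n) p (mid + n) _ _ _ _ _ _ lmax _); try lia.
  (* For [s'] at least [mid], [p] stays in the right part, and the left part of [s'] lies in the
     window of [mid], which [p] dominates. *)
  move=> s' lt_s' j lt_j; exists p; first lia.
  by apply: ub; lia.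
exec; rewrite ifF; last lia.
exec; exec; rewrite leqnn addn1.
apply: terminates_le
    (IH mid.+1 hi mid (mid + n) p (mid + n) _ _ _ _ _ _ _ rmax); try lia.
(* Symmetrically, for [s'] at most [mid], [p] stays in the left part, and the right part of [s']
   lies in the window of [mid]. *)
move=> s' lt_s' j lt_j; exists p; first lia.
by apply: ub; lia.
Qed.

(** The latest output comes first in [written], so the backward pass lists its outputs in increasing
    order. The bound [i.-1 <= p] admits the initial [p = n - 1] with [i = n], where [[i, n)] is
    empty. *)
Lemma left_pass_correct c hi s e b :
  c <= n -> hi <= n -> s <= n -> e <= 4 * n ->
  (forall s', s' < c -> left_max s') ->
  (forall p, p < n -> term b (Config 31 (cells c hi s 0 p e) (outputs 0 c))) ->
  forall i p, i <= n -> i.-1 <= p < n -> bounds i n p ->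
  term (b + 8 * i + 2) (Config 23 (cells c hi s i p e) (outputs i c)).
Proof.
move=> le_c le_hi le_s le_e lmax post; elim=> [|i IH] p le_i lt_p ub.
  exec; exec; rewrite leqnn.
  by apply: terminates_le (post p _); lia.
exec; exec; rewrite subn1 /=.
apply: terminates_compare => //=; [lia | lia | lia | fit |].
have next p' : i <= p' < n -> bounds i n p' ->
    term (b + 8 * i + 5) (Config 28 (cells c hi s i p' e) (outputs i.+1 c)).
  move=> lt_p' ub'.
  have {}IH :
      term (b + 8 * i + 2) (Config 23 (cells c hi s i p' e) (outputs i c)).
    by apply: IH => //; lia.
  case: (leqP c i) => [le_ci|lt_ic].
    exec; rewrite le_ci; apply: terminates_le (_ : _ <= _) _; last first.
      rewrite outputs_nil ?(leq_trans le_ci) // -(outputs_nil le_ci).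
      exact: IH.
    lia.
  exec; rewrite ifF; last lia.
  apply: terminates_output => //=; [lia | lia | fit |].
  exec; rewrite leqnn -(outE (s := i)) ?(leq_trans lt_ic) //; last 2 first.
  - lia.
  - by move=> j; apply: left_max_bounds => //; apply: lmax.
  by rewrite -outputs_cons //; apply: terminates_le IH; lia.
case: ifPn => [le_ip|]; last rewrite -ltNge => /ltW le_pi.
  apply: terminates_le (next p _ (bounds_left ub le_ip)); lia.
exec; rewrite muln1.
apply: terminates_le (next i _ (bounds_left_max ub le_pi)); lia.
Qed.

(** At the loop test [[n, i)] has been scanned, which is the right part of window [i - n]; hence the
    outputs from [c] up to [i - n] are written. The forward pass lists them in reverse. *)
Lemma right_pass_correct c hi :
  0 < c -> c <= n -> hi <= n ->
  (forall s', c <= s' < n -> right_max s') ->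
  forall k i s p, i + k = (n + n).-1 -> s <= n -> n <= p <= i -> bounds n i p ->
  term (9 * k + 1) (Config 35 (cells c hi s i p (n + n).-1)
                              (rev (outputs c (i.+1 - n)) ++ outputs 0 c)).
Proof.
move=> c_gt0 le_c le_hi rmax; elim=> [|k IH] i s p Ei le_s lt_p ub.
  rewrite addn0 in Ei; subst i.
  exec; rewrite leqnn; apply: Terminates_now; first fit.
  split=> //=; rewrite prednK ?addnK; last lia.
  rewrite perm_catC perm_sym -{1}(subnKC le_c) iotaD map_cat /outputs subn0.
  by rewrite perm_cat2l perm_sym perm_rev.
exec; rewrite ifF; last lia.
apply: terminates_compare => //=; [lia | lia | lia | fit |].
have next p' : n <= p' <= i -> bounds n i.+1 p' ->
    term (9 * k + 7) (Config 38 (cells c hi s i p' (n + n).-1)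
                        (rev (outputs c (i.+1 - n)) ++ outputs 0 c)).
  move=> lt_p' ub'; exec; exec; rewrite addn1.
  have {}IH := IH i.+1 (i.+1 - n) p' _ _ _ ub'.
  case: (leqP c (i.+1 - n)) => [le_cs|lt_sc].
    exec; rewrite le_cs; apply: terminates_output => //=; [lia | lia | fit |].
    exec; rewrite leqnn -(outE (s := i.+1 - n)); last 3 first.
    - lia.
    - lia.
    - move=> j; apply: right_max_bounds; last by apply: rmax; lia.
      by rewrite subnK //; lia.
    have E : rev (outputs c (i.+2 - n)) =
        (i.+1 - n, out (i.+1 - n)) :: rev (outputs c (i.+1 - n)).
      by rewrite -rev_rcons -outputs_rcons // -subSn //; lia.
    rewrite -cat_cons -E.
    by apply: terminates_le (IH _ _ _); lia.
  exec; rewrite ifF; last lia.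
  exec; rewrite leqnn (@outputs_nil c (i.+1 - n)); last lia.
  rewrite -(@outputs_nil c (i.+2 - n)); last lia.
  by apply: terminates_le (IH _ _ _); lia.
case: ifPn => [le_ip|]; last rewrite -ltNge => /ltW le_pi.
  by apply: terminates_le (next p _ (bounds_right ub le_ip)); lia.
exec; rewrite muln1.
by apply: terminates_le (next i _ (bounds_right_max ub le_pi)); lia.
Qed.

Lemma sliding_max_program_terminates :
  term (100 * n * (trunc_log 2 n).+1) (init T n).
Proof.
set t := (trunc_log 2 n).+1.
(* These bounds let [lia] absorb the lower order terms into a multiple of [n * t]. *)
have t_gt0 : 0 < t by [].
have le_nt : n <= n * t by rewrite leq_pmulr.
have le_tn : t <= n * t by rewrite leq_pmull.
rewrite /init; exec; exec; exec; exec; exec; rewrite addn0.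
have Tn : n < 2 ^ t by apply: trunc_log_ltn.
have search := search_correct (b := 8 * n + (9 * n + 9)) _ (k := t).
apply: terminates_le (search _ _ _ _ _ _ _ _ _ _ _ _ _ _ _ _) => //=; try lia.
move=> c s i p e le_c le_s le_i le_p le_e lmax rmax.
have c_gt0 : 0 < c.
  (* Window 0 has an empty right part, so [right_max 0] fails at position 0. *)
  rewrite lt0n; apply/eqP => c0.
  by have [||q] := rmax 0 _ 0; rewrite ?c0 ?n_gt0 //; lia.
exec; exec; rewrite muln1 subn1.
rewrite -(@outputs_nil n c) //.
have left_pass := left_pass_correct (b := 9 * n + 4) le_c le_c le_s le_e lmax.
apply: terminates_le (left_pass _ _ _ _ _ _); try lia; last first.
  by move=> j; lia.
move=> q lt_q; exec; exec; exec; exec; rewrite muln1 subn1.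
apply: terminates_le; last first.
  have := @right_pass_correct c c c_gt0 le_c le_c rmax n.-1 n s n.
  rewrite subSnn (@outputs_nil c 1) //; apply; try lia.
  by move=> j; lia.
lia.
Qed.

End SlidingMax.

(** * Space in bits *)

Lemma nbits_le a b : a <= b -> nbits a <= nbits b.
Proof. by move=> le_ab; rewrite ltnS leq_trunc_log. Qed.

(** With [L = trunc_log 2 n], the program counter takes at most 6 bits and each of the nine cells at
    most [L + 3], in total [9 * L + 33]. *)
Lemma fits_space (T : Type) (n : nat) (c : config T) : 0 < n -> fits n c ->
  space_used c <= 33 * (trunc_log 2 n).+1.
Proof.
move=> n_gt0 [lt_pc le_size le_mem].
have Epc : nbits (pc c) <= 6 by apply: leq_trans (@nbits_le _ 44 _) _.
have En : nbits (4 * n) = (trunc_log 2 n).+3.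
  by rewrite /nbits -(mulnA 2 2) !mul2n !trunc_log2_double ?double_gt0.
have Emem : sumn (map nbits (memory c)) <= size (memory c) * (trunc_log 2 n).+3.
  rewrite -En; elim: (memory c) le_mem => //= v m IH /andP[le_v /IH].
  by rewrite mulSn; apply/leq_add/nbits_le.
have : size (memory c) * (trunc_log 2 n).+3 <= 9 * (trunc_log 2 n).+3.
  by rewrite leq_mul2r le_size orbT.
rewrite /space_used; lia.
Qed.

Lemma sliding_max_program_computes :
  computes sliding_max_program sliding_MAX
    (fun n => 100 * n * (trunc_log 2 n).+1) (fun n => 33 * (trunc_log 2 n).+1).
Proof.
move=> d T n x; pose x0 := tnth x (Ordinal (window_subproof ord0 ord0)).
have [t [c [le_t Et [halt_c perm_c] safe_t]]] := terminates_iter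
  (@sliding_max_program_terminates d T n.+1 x x0 (nth x0 (sliding_MAX x))
     isT (size_tuple x) (@sliding_MAX_nth d T n x x0)).
exists t, c; split=> //.
  by move=> u c' le_u Eu; apply: fits_space => //; apply: safe_t Eu.
apply: perm_trans perm_c _; rewrite -val_enum_ord -map_comp.
by rewrite [X in perm_eq _ X](_ : _ =
    [seq (nat_of_ord i, nth x0 (sliding_MAX x) i) | i <- enum 'I_n.+1]) //; apply: eq_map => i; rewrite (tnth_nth x0).
Qed.

(** * Duality between maximum and minimum *)

Definition swap_compare (i : instr) : instr :=
  if i is Compare r s l then Compare s r l else i.

Lemma step_swap_compare (d : Order.disp_t) (T : orderType d) (p : program)
    (x : seq T) (c : config T) :
  step (map swap_compare p) x c = step (T := T^d) p x c.
Proof.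
case: c => l m w; rewrite /step onth_map.
case: (onth p l) => [[]|] //= r s l'.
by case: (onth x (nth 0 m r)) (onth x (nth 0 m s)) => [a|] [b|].
Qed.

Lemma MIN_dual (d : Order.disp_t) (T : orderType d) (n : nat)
    (y : n.+1.-tuple T) :
  MIN y = MAX (T := T^d) y.
Proof.
rewrite /MIN /MAX; apply: (eq_big_op (fun=> True)) => // a b _ _.
by rewrite minEle [RHS]maxEle leEdual; case: (ltgtP a b).
Qed.

(** As [computes] ranges over all orders, it applies to [T^d]; the swapped program on [T] goes
    through the same configurations. *)
Lemma computes_dual (p : program) (time space : nat -> nat) :
  computes p sliding_MAX time space ->
  computes (map swap_compare p) sliding_MIN time space.
Proof.
move=> comp d T n x.
have [t [c [le_t Et halt_c space_t perm_c]]] := comp _ T^d n x.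
have Erun u : run (map swap_compare p) n.+1 x u = run (T := T^d) p n.+1 x u.
  rewrite /run; elim: u => //= u ->.
  by case: (iter _ _ _) => //= c'; apply: step_swap_compare.
exists t, c; split=> //.
- by rewrite Erun.
- by rewrite /halted onth_map halt_c.
- by move=> u c' le_u; rewrite Erun; apply: space_t.
congr (perm_eq _ _): perm_c; apply: eq_map => i.
by rewrite !tnth_mktuple MIN_dual.
Qed.

(** * Asymptotic bounds *)

Local Open Scope ring_scope.

Lemma in_bigO_le (f : nat -> nat) (g : forall R : realType, nat -> R) :
  (forall R : realType, exists K : R,
    forall n, (1 < n)%N -> (f n)%:R <= K * g R n) -> in_bigO f g.
Proof.
move=> fg R; have [K le_f] := fg R.
(* A positive constant is required, while [K] may have any sign. *)
apply/eqO_exP; exists (`|K| + 1); first by rewrite ltr_pwDr.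
exists 2%N => // n /= lt_n.
rewrite ger0_norm // (le_trans (le_f n lt_n)) //.
rewrite (le_trans (ler_norm _)) // normrM.
by rewrite ler_wpM2r // lerDl.
Qed.

(** For [n] at least 2, [L = trunc_log 2 n] is positive, so [L + 1] is at most [2 * L]; and
    [2 ^ L <= n] bounds [L * ln 2] by [ln n]. *)
Lemma trunc_log_le_ln (R : realType) (n : nat) : (1 < n)%N ->
  (trunc_log 2 n).+1%:R <= 2 / ln 2 * ln (n%:R : R).
Proof.
move=> n_gt1; have ln2_gt0 : 0 < ln 2 :> R by rewrite ln_gt0 ?ltr1n.
rewrite mulrAC ler_pdivlMr // -[leRHS]mulrC.
have le_t : (trunc_log 2 n).+1%:R * ln 2 <= (trunc_log 2 n)%:R * ln 2 * 2 :> R.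
  rewrite -mulrA [ln 2 * _]mulrC mulrA ler_pM2r // -natrM ler_nat muln2 -addnn.
  by rewrite -addn1 leq_add2l trunc_log_gt0.
apply: le_trans le_t _; rewrite ler_pM2r // mulr_natl -lnXn //.
rewrite ler_ln ?posrE ?exprn_gt0 ?ltr0n ?(ltnW n_gt1) // -natrX ler_nat.
by rewrite trunc_logP // ltnW.
Qed.

Lemma time_in_bigO (k : nat) :
  in_bigO (fun n => (k * n * (trunc_log 2 n).+1)%N)
    (fun (R : realType) (n : nat) => n%:R * ln (n%:R : R)).
Proof.
apply: in_bigO_le => R; exists (k%:R * (2 / ln 2)) => n n_gt1.
rewrite !natrM mulrACA ler_wpM2l ?mulr_ge0 ?ler0n //.
exact: trunc_log_le_ln.
Qed.

Lemma space_in_bigO (k : nat) :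
  in_bigO (fun n => (k * (trunc_log 2 n).+1)%N)
    (fun (R : realType) (n : nat) => ln (n%:R : R)).
Proof.
apply: in_bigO_le => R; exists (k%:R * (2 / ln 2)) => n n_gt1.
by rewrite natrM -mulrA ler_wpM2l ?ler0n ?trunc_log_le_ln.
Qed.

Theorem theorem17 :
  (exists (p : program) (time space : nat -> nat),
     [/\ computes p sliding_MAX time space,
         in_bigO time (fun (R : realType) (n : nat) => n%:R * ln (n%:R : R))
       & in_bigO space (fun (R : realType) (n : nat) => ln (n%:R : R))])
  /\
  (exists (p : program) (time space : nat -> nat),
     [/\ computes p sliding_MIN time space,
         in_bigO time (fun (R : realType) (n : nat) => n%:R * ln (n%:R : R))
       & in_bigO space (fun (R : realType) (n : nat) => ln (n%:R : R))]).
Proof.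
have comp := sliding_max_program_computes.
split;
  [exists sliding_max_program | exists (map swap_compare sliding_max_program)];
  exists (fun n => 100 * n * (trunc_log 2 n).+1)%N;
  exists (fun n => 33 * (trunc_log 2 n).+1)%N; split;
  by [exact: comp | exact: computes_dual | exact: time_in_bigO
     | exact: space_in_bigO].
Qed.
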